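(* Let $d\geq 2$ be even. Then there is a constant $C>0$, independent of $q$, $j$ and $g$, such that for every finite field $\mathbb F_q$ of odd characteristic, every $j\in\mathbb F_q\setminus\{0\}$, with $S_j=\{x\in\mathbb F_q^d: x_1^2+\cdots+x_d^2=j\}$, and every homogeneous function of degree zero $g:\mathbb F_q^d\to\mathbb C$, $$\Big(\frac{1}{|S_j|}\sum_{x\in S_j}|\widehat g(x)|^2\Big)^{1/2}\le C\Big(\sum_{m\in\mathbb F_q^d}|g(m)|^{\frac{2d+4}{d+4}}\Big)^{\frac{d+4}{2d+4}}.$$
   Context: $\mathbb F_q$ denotes a finite field with $q$ elements whose characteristic is greater than two, and $\chi$ is a fixed nontrivial additive character of $\mathbb F_q$. For $g:\mathbb F_q^d\to\mathbb C$, its Fourier transform is $\widehat g(x)=\sum_{m\in\mathbb F_q^d}\chi(-m\cdot x)g(m)$ for $x\in\mathbb F_q^d$. A function $g:\mathbb F_q^d\to\mathbb C$ is homogeneous of degree zero if $g(sm)=g(m)$ for all $m\in\mathbb F_q^d$ and all $s\in\mathbb F_q\setminus\{0\}$. *)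

(* Defs.v *)
From HB Require Import structures.
From mathcomp Require Import all_boot all_order all_algebra all_field.
Set Implicit Arguments. Unset Strict Implicit. Unset Printing Implicit Defensive.
Import Order.TTheory GRing.Theory Num.Theory.
Local Open Scope ring_scope.

(* Rational power x^(a/b) of a nonnegative real x in a numClosedFieldType:
   the nonnegative real b-th root of x^a. *)
Definition qpow (K : numClosedFieldType) (x : K) (a b : nat) : K := b.-root (x ^+ a).

Definition dotv (F : fieldType) (d : nat) (m x : 'rV[F]_d) : F :=
  \sum_(i < d) m 0 i * x 0 i.

Definition nontriv_add_char (F : finFieldType) (K : numClosedFieldType) (chi : F -> K) :=
  [/\ chi 0 = 1, (forall a b, chi (a + b) = chi a * chi b) & exists a, chi a != 1].

Definition fourier (F : finFieldType) (K : numClosedFieldType) (d : nat)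
  (chi : F -> K) (g : 'rV[F]_d -> K) (x : 'rV[F]_d) : K :=
  \sum_(m : 'rV[F]_d) chi (- dotv m x) * g m.

Definition sphere (F : finFieldType) (d : nat) (j : F) : {set 'rV[F]_d} :=
  [set x : 'rV[F]_d | \sum_(i < d) x 0 i ^+ 2 == j].

Definition homog0 (F : finFieldType) (K : Type) (d : nat) (g : 'rV[F]_d -> K) :=
  forall (m : 'rV[F]_d) (s : F), s != 0 -> g (s *: m) = g m.

(* Main.v *)
(* If [g] is homogeneous of degree zero, then so is its Fourier transform, hence
   the sum of its squared modulus over [S_j] equals the sum over any dilate
   [s S_j], [s != 0]. The [q - 1] dilates cover every point at most twice, so by
   Plancherel [(q - 1) * sum_(S_j) |g^|^2 <= 2 q^d ||g||_2^2]. As [|S_j|] is at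
   least of order [q^(d-1)], the mean over [S_j] is [O(||g||_2^2)], and
   [||g||_2 <= ||g||_p] for the counting measure because
   [p = (2d+4)/(d+4) <= 2]. *)

Require Import Defs.
From HB Require Import structures.
From mathcomp Require Import all_boot all_order all_algebra all_field.
From mathcomp Require Import ring zify.
Set Implicit Arguments. Unset Strict Implicit. Unset Printing Implicit Defensive.
Import Order.TTheory GRing.Theory Num.Theory.
Local Open Scope ring_scope.

(** * Bilinearity of the dot product *)

Lemma dotvC (F : fieldType) d (x y : 'rV[F]_d) : dotv x y = dotv y x.
Proof. by apply: eq_bigr => i _; rewrite mulrC. Qed.

Lemma dotvDl (F : fieldType) d (x y z : 'rV[F]_d) :
  dotv (x + y) z = dotv x z + dotv y z.
Proof. by rewrite -big_split; apply: eq_bigr => i _; rewrite mxE mulrDl. Qed.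

Lemma dotvZl (F : fieldType) d a (x y : 'rV[F]_d) :
  dotv (a *: x) y = a * dotv x y.
Proof. by rewrite mulr_sumr; apply: eq_bigr => i _; rewrite mxE mulrA. Qed.

Lemma dotvDr (F : fieldType) d (x y z : 'rV[F]_d) :
  dotv x (y + z) = dotv x y + dotv x z.
Proof. by rewrite !(dotvC x) dotvDl. Qed.

Lemma dotvZr (F : fieldType) d a (x y : 'rV[F]_d) :
  dotv x (a *: y) = a * dotv x y.
Proof. by rewrite !(dotvC x) dotvZl. Qed.

Lemma dotv_delta (F : fieldType) d (x : 'rV[F]_d) i :
  dotv x (delta_mx 0 i) = x 0 i.
Proof.
rewrite /dotv (bigD1 i) //= mxE !eqxx mulr1 big1 ?addr0 // => k /negPf ki.
by rewrite mxE eqxx ki mulr0.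
Qed.

Lemma in_sphere (F : finFieldType) d (j : F) (x : 'rV[F]_d) :
  (x \in sphere d j) = (dotv x x == j).
Proof. by rewrite inE; congr (_ == _); apply: eq_bigr => i _. Qed.

(** * Counting arguments and a lower bound for the size of a sphere *)

Lemma card_root_subset (F : finFieldType) (p : {poly F}) (n : nat) (A : {pred F}) :
  p != 0 -> (size p <= n.+1)%N -> {in A, forall t, root p t} -> (#|A| <= n)%N.
Proof.
move=> p0 sp rA; rewrite -ltnS cardE; apply: leq_trans sp.
apply: max_poly_roots => //; last exact: enum_uniq.
by apply/allP => t; rewrite mem_enum; apply: rA.
Qed.

Lemma card_fibers (S T : finType) (f : S -> T) (A : {set S}) (B : {set T}) k :
  {in A, forall x, f x \in B} ->
  {in B, forall y, #|[set x in A | f x == y]| <= k}%N ->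
  (#|A| <= #|B| * k)%N.
Proof.
move=> fAB fib; rewrite -sum1_card (partition_big f (mem B)) //=.
rewrite -sum_nat_const; apply: leq_sum => y /fib; rewrite -sum1_card.
by congr (_ <= _)%N; apply: eq_bigl => x; rewrite inE.
Qed.

(** Pigeonhole: squaring is at most two-to-one on nonzero elements, so with 0 the set [A] of squares
    fills more than half of [F] and must meet [j - A]. *)
Lemma sum2sqr (F : finFieldType) (j : F) : exists a b : F, a ^+ 2 + b ^+ 2 = j.
Proof.
pose A := [set a ^+ 2 | a : F]; pose B := [set j - b | b in A].
have cB : #|B| = #|A| by apply: card_imset; apply: (can_inj (subKr j)).
have cA : (#|F| < #|A| + #|A|)%N.
  have A0 : 0 \in A by apply/imsetP; exists 0; rewrite ?expr0n.
  have ltD n m : (n.-1 <= m * 2 -> n < m.+1 + m.+1)%N by lia.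
  rewrite (cardsD1 0 A) A0 add1n; apply: ltD; rewrite -(cardsC1 (0 : F)).
  apply: (@card_fibers F F (fun a => a ^+ 2)) => [a|y _].
    by rewrite !inE sqrf_eq0 => ->; apply: imset_f.
  apply: (@card_root_subset _ ('X^2 - y%:P)).
  - by rewrite -size_poly_eq0 size_XnsubC.
  - by rewrite size_XnsubC.
  - by move=> a; rewrite inE rootE !hornerE subr_eq0 => /andP[].
have : A :&: B != set0.
  apply: contraL cA => /eqP AB0; rewrite -leqNgt.
  have := cardsUI A B; rewrite AB0 cards0 addn0 cB => <-; exact: max_card.
case/set0Pn => y /setIP[/imsetP[a _ ya] /imsetP[_ /imsetP[b _ ->] yb]].
by exists a, b; rewrite -ya yb subrK.
Qed.

Lemma sphere_gt0 (F : finFieldType) d (j : F) :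
  (1 < d)%N -> (0 < #|sphere d j|)%N.
Proof.
case: d => [|[|d]] // _; have [a [b abj]] := sum2sqr j.
apply/card_gt0P; exists (\row_i (if i == 0 then a else if i == 1 then b else 0)).
rewrite inE !big_ord_recl !mxE /= big1 ?addr0 ?abj // => i _.
by rewrite mxE expr0n.
Qed.

(** Double counting of the pairs [(v, t)] with [v + t *: e] in [B]: by translation each [t] accounts
    for exactly [#|B|] of them, and each [v] for at most [k]. *)
Lemma card_lines (F : finFieldType) (V : finLmodType F) (e : V) (B : {set V}) k :
  (forall v : V, #|[set t : F | (v + t *: e)%R \in B]| <= k)%N ->
  (#|F| * #|B| <= #|V| * k)%N.
Proof.
move=> lin; have -> : (#|F| * #|B| = \sum_(v : V) \sum_(t : F) ((v + t *: e)%R \in B))%N.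
  rewrite exchange_big /= -sum_nat_const; apply: eq_bigr => t _.
  rewrite -sum1_card [LHS]big_mkcond [RHS](reindex_inj (addIr (- (t *: e)))) /=.
  by apply: eq_bigr => v _; rewrite subrK; case: (_ \in _).
rewrite -sum_nat_const; apply: leq_sum => v _; apply: leq_trans (lin v).
rewrite -sum1_card [leqRHS]big_mkcond; apply: leq_sum => t _.
by rewrite inE; case: (_ \in _).
Qed.

(** The new point is the mirror image of [P] in the hyperplane orthogonal to [v], and reflections
    preserve the quadratic form. *)
Lemma reflect_sphere (F : finFieldType) d (j : F) (P v : 'rV[F]_d) :
  P \in sphere d j -> dotv v v != 0 ->
  P - (2 * dotv P v / dotv v v) *: v \in sphere d j.
Proof.
rewrite !in_sphere => /eqP PP v0; rewrite -scaleNr.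
rewrite !(dotvDl, dotvDr, dotvZl, dotvZr) (dotvC v P) PP.
apply/eqP; field; exact: v0.
Qed.

(* A vector [v] that is neither isotropic nor orthogonal to [P] reflects [P] to
   a point [x != P] of the sphere, and [v] is then a multiple of [x - P]; the
   remaining [v] meet every line parallel to [P] in at most three points. *)
Lemma card_sphere_subn3 (F : finFieldType) d (j : F) :
  (1 < d)%N -> 2%N \notin [pchar F] -> j != 0 ->
  ((#|F| - 3) * #|F| ^ d <= #|F| ^ 2 * #|sphere d j|)%N.
Proof.
move=> d1 F2 j0; have two0 : (2 : F) != 0 by move: F2; rewrite inE.
have /card_gt0P[P PS] := sphere_gt0 j d1.
have PP : dotv P P = j by apply/eqP; rewrite -in_sphere.
pose B := [set v : 'rV[F]_d | dotv v v * dotv P v == 0].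
have cV : #|{: 'rV[F]_d}| = (#|F| ^ d)%N by rewrite card_mx mul1n.
have cB : (#|F| * #|B| <= #|F| ^ d * 3)%N.
  rewrite -cV; apply: (card_lines (e := P)) => v.
  (* At [t], [p2] and [p1] are the products of [v + t *: P] with itself and with [P]; both have
     leading coefficient [j != 0], so [p2 * p1] has degree 3. *)
  pose p2 : {poly F} := j *: 'X^2 + (2 * dotv P v) *: 'X + (dotv v v)%:P.
  pose p1 : {poly F} := j *: 'X + (dotv P v)%:P.
  have s2 : size p2 = 3%N.
    rewrite /p2 -addrA size_polyDl size_scale ?size_polyXn //.
    rewrite (leq_ltn_trans (size_polyD _ _)) // gtn_max size_polyC.
    rewrite (leq_ltn_trans (size_scale_leq _ _)) ?size_polyX //.
    by case: (_ == _).
  have s1 : size p1 = 2%N.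
    rewrite /p1 size_polyDl size_scale ?size_polyX //.
    by rewrite size_polyC; case: (_ == _).
  have p20 : p2 != 0 by rewrite -size_poly_eq0 s2.
  have p10 : p1 != 0 by rewrite -size_poly_eq0 s1.
  apply: (@card_root_subset _ (p2 * p1)); first by rewrite mulf_neq0.
    by rewrite size_mul // s1 s2.
  move=> t; rewrite !inE => /eqP tB; apply/eqP; rewrite -[RHS]tB.
  rewrite !(dotvDl, dotvDr, dotvZl, dotvZr) (dotvC v P) PP.
  rewrite hornerM /p2 /p1 !hornerD !hornerZ hornerXn hornerX !hornerC; ring.
have inCB v : (v \in ~: B) = (dotv v v != 0) && (dotv P v != 0).
  by rewrite !inE mulf_eq0 negb_or.
have cfib : (#|~: B| <= #|sphere d j| * #|F|)%N.
  apply: (card_fibers (f := fun v => P - (2 * dotv P v / dotv v v) *: v)) => [v|x xS].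
    by rewrite inCB => /andP[v0 _]; apply: reflect_sphere.
  apply: leq_trans (leq_imset_card (fun a : F => a *: (x - P)) F).
  apply/subset_leq_card/subsetP => v; rewrite inE inCB.
  case/andP=> /andP[v0 Pv0] /eqP <-.
  have c0 : 2 * dotv P v / dotv v v != 0 by rewrite !mulf_neq0 ?invr_eq0.
  apply/imsetP; exists (- (2 * dotv P v / dotv v v)^-1) => //.
  by rewrite addrAC subrr add0r scalerN scaleNr opprK scalerA mulVf ?scale1r.
(* With q = [#|F|], splitting the space into [B] and its complement gives q^(d+1) <= 3 q^d + q^2
   [#|sphere d j|]. *)
rewrite mulnBl leq_subLR.
have -> : (#|F| * #|F| ^ d = #|F| * #|B| + #|F| * #|~: B|)%N.
  by rewrite -mulnDr cardsC cV.
rewrite -[X in (_ <= X + _)%N]mulnC leq_add //.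
by rewrite -mulnn -mulnA leq_mul2l [(#|F| * #|sphere _ _|)%N]mulnC cfib orbT.
Qed.

(** The preceding bound is void for q <= 3, where q^d <= 3^d and nonemptiness of the sphere suffice.
    For q >= 4 it applies through q <= 4 (q - 3) and 4 <= 9 <= 3^d. *)
Lemma card_sphere_ge (F : finFieldType) d (j : F) :
  (1 < d)%N -> 2%N \notin [pchar F] -> j != 0 ->
  (#|F| ^ d <= 3 ^ d * (#|F| * #|sphere d j|))%N.
Proof.
move=> d1 F2 j0; have := card_sphere_subn3 d1 F2 j0.
have S0 := sphere_gt0 j d1.
have d9 : (9 <= 3 ^ d)%N by apply: (@leq_pexp2l 3 2 d).
have q0 : (0 < #|F|)%N by apply: ltnW (finNzRing_gt1 F).
have [q3 _|q3 le] := leqP #|F| 3.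
  by apply: leq_trans (leq_pmulr _ _); rewrite ?muln_gt0 ?q0 ?leq_exp2r // ltnW.
move: #|F| (#|F| ^ d)%N #|sphere d j| (3 ^ d)%N q3 q0 le d9 => q Q s c q3 q0 le d9.
rewrite -(leq_pmul2l q0); apply: (@leq_trans (4 * ((q - 3) * Q))%N).
  by rewrite mulnA leq_mul2r; apply/orP; right; lia.
apply: leq_trans (leq_mul (isT : 4 <= 4)%N le) _.
have -> : (q * (c * (q * s)) = c * (q ^ 2 * s))%N by ring.
by rewrite leq_mul2r (leq_trans _ d9) ?orbT.
Qed.

(** * Additive characters and Fourier transforms of homogeneous functions *)

(** In characteristic p, [a *+ p = 0] makes [chi a] a p-th root of unity. *)
Lemma add_char_norm (F : finFieldType) (K : numClosedFieldType) (chi : F -> K) a :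
  nontriv_add_char chi -> `|chi a| = 1.
Proof.
case=> chi0 chiD _; have [p p_pr pF] := finPcharP F.
have chiMn n : chi (a *+ n) = chi a ^+ n.
  by elim: n => [|n IHn]; rewrite ?mulr0n ?chi0 // mulrS chiD IHn exprS.
apply/eqP; rewrite -(@pexpr_eq1 _ _ p) ?prime_gt0 // -normrX -chiMn.
by rewrite mulrn_pchar // chi0 normr1.
Qed.

Lemma add_char_conj (F : finFieldType) (K : numClosedFieldType) (chi : F -> K) a :
  nontriv_add_char chi -> (chi a)^* = chi (- a).
Proof.
move=> chiP; have [chi0 chiD _] := chiP.
have chi_n0 : chi a != 0 by rewrite -normr_eq0 (add_char_norm _ chiP) oner_eq0.
apply: (mulfI chi_n0); rewrite -normCK (add_char_norm _ chiP) expr1n -chiD.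
by rewrite subrr chi0.
Qed.

Lemma add_char_ortho (F : finFieldType) (K : numClosedFieldType) (chi : F -> K)
    d (m : 'rV[F]_d) :
  nontriv_add_char chi ->
  \sum_(x : 'rV[F]_d) chi (dotv m x) = (#|F| ^ d)%:R * (m == 0)%:R.
Proof.
case=> chi0 chiD [a chia]; have [->|m0] := eqVneq m 0.
  rewrite mulr1 (eq_bigr (fun=> 1)) => [|x _].
    by rewrite sumr_const card_mx mul1n.
  by rewrite -(scale0r 0) dotvZl mul0r chi0.
rewrite mulr0; have [i mi] : exists i, m 0 i != 0.
  by apply/existsP; rewrite -negb_forall; apply: contra m0 => /forallP m0;
    apply/eqP/rowP => i; rewrite mxE; apply/eqP.
(* Translating by a vector [y] with [dotv m y = a] multiplies the sum by [chi a]. *)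
pose y : 'rV[F]_d := (a / m 0 i) *: delta_mx 0 i.
have my : dotv m y = a by rewrite dotvZr dotv_delta divfK.
set S := LHS; have : (chi a - 1) * S = 0.
  rewrite mulrBl mul1r {2}/S (reindex_inj (addrI y)) mulr_sumr -sumrB big1 // => x _.
  by rewrite dotvDr my chiD subrr.
by move/eqP; rewrite mulf_eq0 subr_eq0 (negPf chia) => /eqP.
Qed.

(** Plancherel: after expanding the square, orthogonality in [x] leaves only the diagonal terms
    [n = m]. *)
Lemma sum_fourier_sqr (F : finFieldType) (K : numClosedFieldType) (chi : F -> K)
    d (g : 'rV[F]_d -> K) :
  nontriv_add_char chi ->
  \sum_x `|fourier chi g x| ^+ 2 = (#|F| ^ d)%:R * \sum_m `|g m| ^+ 2.
Proof.
move=> chiP; have [_ chiD _] := chiP.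
transitivity (\sum_x \sum_m \sum_n g m * (g n)^* * chi (dotv (n - m) x)).
  apply: eq_bigr => x _; rewrite normCK /fourier rmorph_sum mulr_suml.
  apply: eq_bigr => m _; rewrite mulr_sumr; apply: eq_bigr => n _.
  rewrite rmorphM /= (add_char_conj _ chiP) opprK -scaleN1r dotvDl dotvZl mulN1r.
  by rewrite chiD; ring.
rewrite exchange_big mulr_sumr; apply: eq_bigr => m _; rewrite exchange_big /=.
rewrite (bigD1 m) //= [X in _ + X]big1 => [|n nm]; rewrite -mulr_sumr.
  by rewrite add_char_ortho // subrr eqxx mulr1 addr0 -normCK mulrC.
by rewrite add_char_ortho // subr_eq0 (negPf nm) !mulr0.
Qed.

(** The factor [s] moves across the dot product onto [m], where reindexing absorbs it. *)
Lemma fourier_homog0 (F : finFieldType) (K : numClosedFieldType) (chi : F -> K)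
    d (g : 'rV[F]_d -> K) :
  homog0 g -> homog0 (fourier chi g).
Proof.
move=> gh x s s0; rewrite /fourier [RHS](reindex_inj (scalerI s0)) /=.
by apply: eq_bigr => m _; rewrite gh // dotvZl dotvZr.
Qed.

Lemma sum_sphere_homog0 (F : finFieldType) (K : numDomainType) d (j : F)
    (f : 'rV[F]_d -> K) :
  j != 0 -> homog0 f -> (forall x, 0 <= f x) ->
  #|F|.-1%:R * \sum_(x in sphere d j) f x <= 2 * \sum_x f x.
Proof.
move=> j0 fh f0; rewrite -(cardsC1 (0 : F)) mulr_natl -sumr_const mulr_sumr.
have -> : \sum_(s in [set~ (0 : F)]) \sum_(x in sphere d j) f x =
    \sum_y f y *+ #|[set s in [set~ (0 : F)] | s^-1 *: y \in sphere d j]|.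
  transitivity (\sum_(s in [set~ (0 : F)]) \sum_(y | s^-1 *: y \in sphere d j) f y).
    apply: eq_bigr => s; rewrite !inE => s0.
    rewrite [RHS](reindex_inj (scalerI s0)) /=.
    by apply: eq_big => [x|x _]; rewrite ?scalerK ?fh.
  rewrite (exchange_big_dep predT) //=; apply: eq_bigr => y _.
  by rewrite -sumr_const; apply: eq_bigl => s; rewrite [RHS]inE.
apply: ler_sum => y _; rewrite mulr_natl ler_wpMn2l //.
(* The point [y] lies on the dilate of the sphere by [s] only if [j * s ^+ 2 = dotv y y], which at
   most two [s] satisfy. *)
pose p : {poly F} := j *: 'X^2 - (dotv y y)%:P.
have sp : size p = 3%N.
  rewrite /p size_polyDl size_scale ?size_polyXn // size_polyN size_polyC.
  by case: (_ == _).
apply: (@card_root_subset _ p); rewrite -?size_poly_eq0 ?sp //.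
move=> s; rewrite in_set in_sphere !inE => /andP[s0 /eqP].
rewrite dotvZl dotvZr rootE /p hornerD hornerN hornerZ hornerXn hornerC => <-.
by apply/eqP; field.
Qed.

(** * Comparison of norms for the counting measure *)

(** Each [u i] is at most N = [a.-root T], so [u i ^+ n] is at most N^(n-a) times [u i ^+ a];
    summing gives N^(n-a) N^a. *)
Lemma sum_exp_le_root (K : numClosedFieldType) (I : finType) (u : I -> K) a n :
  (0 < a)%N -> (a <= n)%N -> (forall i, 0 <= u i) ->
  \sum_i u i ^+ n <= a.-root (\sum_i u i ^+ a) ^+ n.
Proof.
move=> a0 an u0; set T := \sum_i u i ^+ a.
have ua0 i : 0 <= u i ^+ a by apply: exprn_ge0.
have T0 : 0 <= T by apply: sumr_ge0.
have uT i : u i <= a.-root T.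
  rewrite -(exprCK a0 (u0 i)) ler_rootC ?nnegrE // /T (bigD1 i) //= lerDl.
  by apply: sumr_ge0.
rewrite -(subnK an) [leRHS]exprD rootCK // mulr_sumr; apply: ler_sum => i _.
by rewrite exprD ler_wpM2r // lerXn2r ?nnegrE ?rootC_ge0.
Qed.

(** Passing to the b-th roots [u i] of the moduli turns the exponents a/b and 2 into the integers a
    and 2b, with [a <= b * 2] expressing a/b <= 2. *)
Lemma sqrtC_sum_sqr_le_qpow (K : numClosedFieldType) (I : finType) (f : I -> K) a b :
  (0 < a)%N -> (0 < b)%N -> (a <= b * 2)%N ->
  sqrtC (\sum_i `|f i| ^+ 2) <= qpow (\sum_i qpow `|f i| a b) b a.
Proof.
move=> a0 b0 ab; pose u i := b.-root `|f i|.
have u0 i : 0 <= u i by rewrite rootC_ge0.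
have -> : \sum_i qpow `|f i| a b = \sum_i u i ^+ a.
  by apply: eq_bigr => i _; rewrite /qpow rootCX.
have -> : \sum_i `|f i| ^+ 2 = \sum_i u i ^+ (b * 2).
  by apply: eq_bigr => i _; rewrite exprM rootCK.
have T0 : 0 <= \sum_i u i ^+ a by apply: sumr_ge0 => i _; apply: exprn_ge0.
rewrite /qpow rootCX // -[leRHS]sqrCK ?exprn_ge0 ?rootC_ge0 //.
rewrite -exprM ler_sqrtC ?nnegrE ?exprn_ge0 ?rootC_ge0 //.
  exact: sum_exp_le_root.
by apply: sumr_ge0 => i _; apply: exprn_ge0.
Qed.

(** * The mean over the sphere and the final estimate *)

Lemma mean_sphere_fourier_le (F : finFieldType) (K : numClosedFieldType) (chi : F -> K)
    d (j : F) (g : 'rV[F]_d -> K) :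
  (1 < d)%N -> 2%N \notin [pchar F] -> nontriv_add_char chi -> j != 0 -> homog0 g ->
  #|sphere d j|%:R^-1 * \sum_(x in sphere d j) `|fourier chi g x| ^+ 2
    <= (4 * 3 ^ d)%:R * \sum_m `|g m| ^+ 2.
Proof.
move=> d1 F2 chiP j0 gh.
have S0 := sphere_gt0 j d1.
have q1 := finNzRing_gt1 F.
have g0 : 0 <= \sum_m `|g m| ^+ 2 by apply: sumr_ge0 => m _; apply: exprn_ge0.
have /= := @sum_sphere_homog0 _ K d j (fun x => `|fourier chi g x| ^+ 2) j0.
rewrite sum_fourier_sqr // => H.
rewrite ler_pdivrMl ?ltr0n //.
rewrite -(@ler_pM2l _ #|F|.-1%:R) ?ltr0n; last by case: #|F| q1 => [|[]].
apply: le_trans (H _ _) _ => [s x s0|x|]; rewrite ?exprn_ge0 ?fourier_homog0 //.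
rewrite !mulrA ler_wpM2r // -!natrM ler_nat.
apply: leq_trans (leq_mul (leqnn 2) (card_sphere_ge d1 F2 j0)) _.
move: #|F| #|sphere d j| (3 ^ d)%N q1 => q s c q1.
(* The factor 4 in the constant comes from 2q <= 4 (q - 1), valid since q >= 2. *)
rewrite (_ : _ * _ = 2 * q * (c * s))%N; last by ring.
rewrite [leqRHS](_ : _ = 4 * q.-1 * (c * s))%N; last by ring.
by rewrite leq_mul2r; apply/orP; right; lia.
Qed.

Theorem theorem2p2 (K : numClosedFieldType) (d : nat) :
  (2 <= d)%N -> ~~ odd d ->
  exists C : K, 0 < C /\
    forall (F : finFieldType) (chi : F -> K),
      (2%N \notin [pchar F]) ->
      nontriv_add_char chi ->
      forall (j : F), j != 0 ->
      forall (g : 'rV[F]_d -> K), homog0 g ->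
        sqrtC ((#|sphere d j|%:R)^-1 *
               \sum_(x in sphere d j) `|fourier chi g x| ^+ 2)
        <= C * qpow (\sum_(m : 'rV[F]_d) qpow `|g m| (2 * d + 4) (d + 4))
                    (d + 4) (2 * d + 4).
Proof.
move=> d2 _; exists (sqrtC (4 * 3 ^ d)%:R); split.
  by rewrite sqrtC_gt0 ltr0n muln_gt0 expn_gt0.
move=> F chi F2 chiP j j0 g gh.
have sum_sqr_ge0 (T : finType) (P : pred T) (f : T -> K) :
    0 <= \sum_(x | P x) `|f x| ^+ 2.
  by apply: sumr_ge0 => x _; apply: exprn_ge0.
apply: (@le_trans _ _ (sqrtC ((4 * 3 ^ d)%:R * \sum_m `|g m| ^+ 2))).
  rewrite ler_sqrtC ?nnegrE ?mulr_ge0 ?invr_ge0 ?ler0n //.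
  exact: mean_sphere_fourier_le.
rewrite rootCMl ?ler0n // ler_wpM2l ?sqrtC_ge0 ?ler0n //.
(* Here a = 2d + 4 and b = d + 4, so a <= 2b = 2d + 8. *)
by apply: sqrtC_sum_sqr_le_qpow; lia.
Qed.
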